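(* Let $A$ be a commutative group, $L$ a loop with identity $\epsilon$, and $(P,Q)$ a loop cocycle with $P,Q:L\times L\to\mathrm{Aut}(A)$. The linear abelian extension $F(P,Q)$ has the left inverse property if and only if $L$ has the left inverse property and the equations $$Q(\xi^{-1},\xi\eta)=Q(\xi,\eta)^{-1},\qquad P(\xi^{-1},\xi\eta)=Q(\xi,\eta)^{-1}P(\xi,\eta)\,Q(\xi^{-1},\xi)^{-1}P(\xi^{-1},\xi)$$ hold for all $\xi,\eta\in L$.
   Context: A loop is a set with a binary multiplication having a two-sided identity element such that all left and right translations are bijections. A loop $L$ has the left inverse property if there is a bijection $\iota:L\to L$ with $\iota(x)\cdot xy=y$ for all $x,y\in L$; then left and right inverses of every $x$ coincide and $\iota(x)=x^{-1}$. Let $A=(A,+)$ be a commutative group and $L$ a loop with identity $\epsilon$. A loop cocycle is a pair $(P,Q)$ of maps $P,Q:L\times L\to\mathrm{Aut}(A)$ with $P(\alpha,\epsilon)=\mathrm{Id}=Q(\epsilon,\beta)$ for all $\alpha,\beta\in L$. The linear abelian extension $F(P,Q)$ of $A$ by $L$ is the set $L\times A$ with multiplication $(\alpha,a)\cdot(\beta,b)=(\alpha\beta,\,P(\alpha,\beta)a+Q(\alpha,\beta)b)$; it is a loop with identity $(\epsilon,0)$. Products and inverses of values of $P,Q$ are taken in the group $\mathrm{Aut}(A)$ (composition). *)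

(* Defs.v *)
From HB Require Import structures.
From mathcomp Require Import all_boot all_algebra.
From mathcomp Require Import boolp.

Set Implicit Arguments.
Unset Strict Implicit.
Unset Printing Implicit Defensive.

Import GRing.Theory.

Local Open Scope group_scope.

HB.mixin Record UMagma_isLoop L of UMagma L := {
  ltrans_bij : forall x : L, bijective (fun y => x * y);
  rtrans_bij : forall x : L, bijective (fun y => y * x)
}.

#[short(type="loopType")]
HB.structure Definition Loop := {L of UMagma_isLoop L & UMagma L}.

Definition left_inverse_property (L : loopType) : Prop :=
  exists iota : L -> L, bijective iota /\ forall x y : L, iota x * (x * y) = y.

Lemma linv_exists (L : loopType) (x : L) : exists y : L, y * x = 1.
Proof. by have [g _ gK] := rtrans_bij x; exists (g 1); rewrite gK. Qed.

(* The unique left inverse of [x]; it exists in every loop. By [lip_iotaE] and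
   [mulg_linv] below, under the left inverse property it is the two-sided
   inverse of [x], and [linv] is the only possible choice of [iota]. *)
Definition linv (L : loopType) (x : L) : L := sval (cid (linv_exists x)).

Lemma linv_mulg (L : loopType) (x : L) : linv x * x = 1.
Proof. by rewrite /linv; case: cid. Qed.

Lemma linv_unique (L : loopType) (x y : L) : y * x = 1 -> y = linv x.
Proof. by rewrite -(linv_mulg x) => /(bij_inj (rtrans_bij x)). Qed.

Lemma lip_iotaE (L : loopType) (iota : L -> L) :
  (forall x y : L, iota x * (x * y) = y) -> iota =1 @linv L.
Proof. by move=> iK x; apply: linv_unique; rewrite -[X in _ * X]mulg1 iK. Qed.

Lemma mulg_linv (L : loopType) (x : L) :
  left_inverse_property L -> x * linv x = 1.
Proof.
case=> iota [_ iK]; apply: (bij_inj (ltrans_bij (iota x))).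
by rewrite /= iK mulg1 (lip_iotaE iK).
Qed.

Record aut (A : zmodType) := Aut {
  aut_fun :> {additive A -> A};
  aut_bij : bijective aut_fun
}.

Section AutGroup.
Variable A : zmodType.
Implicit Types f g h : aut A.

Lemma autP f g : f =1 g -> f = g.
Proof.
case: f g => [[f [[fa]]] fb] [[g [[ga]]] gb] /= /funext fg.
case: g / fg ga gb => ga gb.
by have := Prop_irrelevance fa ga => ->; congr Aut; apply: Prop_irrelevance.
Qed.

HB.instance Definition _ := gen_eqMixin (aut A).
HB.instance Definition _ := gen_choiceMixin (aut A).

Definition aut_one : aut A :=
  @Aut A idfun (Bijective (fun=> erefl) (fun=> erefl)).

Definition aut_mul f g : aut A :=
  @Aut A (f \o g) (bij_comp (aut_bij f) (aut_bij g)).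

Lemma aut_inv_exists f : exists g : aut A, cancel f g /\ cancel g f.
Proof.
have [g fK gK] := aut_bij f.
pose gM := GRing.isNmodMorphism.Build _ _ g (can2_nmod_morphism fK gK).
pose ga : {additive A -> A} := HB.pack g gM.
by exists (@Aut A ga (Bijective gK fK)).
Qed.

Definition aut_inv f : aut A := sval (cid (aut_inv_exists f)).

Lemma aut_invK f : cancel f (aut_inv f).
Proof. by rewrite /aut_inv; case: cid => g []. Qed.

Lemma aut_invKV f : cancel (aut_inv f) f.
Proof. by rewrite /aut_inv; case: cid => g []. Qed.

Lemma aut_mulA : associative aut_mul.
Proof. by move=> f g h; apply: autP. Qed.
Lemma aut_mul1g : left_id aut_one aut_mul.
Proof. by move=> f; apply: autP. Qed.
Lemma aut_mulg1 : right_id aut_one aut_mul.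
Proof. by move=> f; apply: autP. Qed.
Lemma aut_mulVg : left_inverse aut_one aut_inv aut_mul.
Proof. by move=> f; apply: autP => a; rewrite /= aut_invK. Qed.
Lemma aut_mulgV : right_inverse aut_one aut_inv aut_mul.
Proof. by move=> f; apply: autP => a; rewrite /= aut_invKV. Qed.

HB.instance Definition _ := isGroup.Build (aut A)
  aut_mulA aut_mul1g aut_mulg1 aut_mulVg aut_mulgV.

End AutGroup.

Definition loop_cocycle (A : zmodType) (L : loopType) (P Q : L -> L -> aut A) :=
  (forall x : L, P x 1 = 1) /\ (forall y : L, Q 1 y = 1).

(* An alias of the product type, so that the multiplication below does not
   compete with the componentwise one on pairs. *)
Definition linear_extension (A : zmodType) (L : loopType)
  (P Q : L -> L -> aut A) (PQ : loop_cocycle P Q) : Type := (L * A)%type.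

Section LinearExtension.
Variables (A : zmodType) (L : loopType) (P Q : L -> L -> aut A).
Hypothesis PQ : loop_cocycle P Q.
Local Notation F := (linear_extension PQ).

HB.instance Definition _ := Choice.copy F (L * A)%type.

Definition ext_mul (u v : F) : F :=
  (u.1 * v.1, (P u.1 v.1 u.2 + Q u.1 v.1 v.2)%R).

Definition ext_one : F := (1, 0%R).

Lemma ext_mul1g : left_id ext_one ext_mul.
Proof.
by case=> y b; rewrite /ext_mul /= mul1g raddf0 add0r (proj2 PQ).
Qed.

Lemma ext_mulg1 : right_id ext_one ext_mul.
Proof.
by case=> x a; rewrite /ext_mul /= mulg1 raddf0 addr0 (proj1 PQ).
Qed.

HB.instance Definition _ := hasMul.Build F ext_mul.
HB.instance Definition _ := Magma_isUMagma.Build F ext_mul1g ext_mulg1.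

Lemma ext_ltrans_bij (u : F) : bijective (fun v : F => u * v).
Proof.
case: u => x a; have [g gK Kg] := ltrans_bij x.
exists (fun w : F => (g w.1, (Q x (g w.1))^-1 (w.2 - P x (g w.1) a)%R) : F).
- by case=> y b; congr (_, _); rewrite /= gK // addrAC subrr add0r aut_invK.
- case=> z c; rewrite /mul /= /ext_mul /=; congr (_, _); first exact: Kg.
  by rewrite aut_invKV addrC subrK.
Qed.

Lemma ext_rtrans_bij (v : F) : bijective (fun u : F => u * v).
Proof.
case: v => y b; have [g gK Kg] := rtrans_bij y.
exists (fun w : F => (g w.1, (P (g w.1) y)^-1 (w.2 - Q (g w.1) y b)%R) : F).
- by case=> x a; congr (_, _); rewrite /= gK // addrK aut_invK.
- case=> z c; rewrite /mul /= /ext_mul /=; congr (_, _); first exact: Kg.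
  by rewrite aut_invKV subrK.
Qed.

HB.instance Definition _ := UMagma_isLoop.Build F ext_ltrans_bij ext_rtrans_bij.

End LinearExtension.

(* Main.v *)
Require Import Defs.
From mathcomp Require Import all_boot all_algebra.

(** In any loop the only candidate for [iota x] is the left inverse [linv x],
  so the left inverse property is the identity [linv x * (x * y) = y]
  ([left_inverse_propertyE]).  In the extension [F(P, Q)] the left inverse of
  [(x, a)] is [(linv x, a')], where [a'] solves
  [P (linv x) x a' + Q (linv x) x a = 0] ([linv_ext]).  The first component of
  the identity in [F(P, Q)] is then the identity in [L].  The second component
  says that a map additive in [(a, b)] is the projection [(a, b) |-> b]; setting
  [a = 0] and [b = 0] in turn splits it into one equation in [Aut(A)] for the
  coefficient of [b] and one for that of [a], and these are the stated
  equations for [Q] and [P] ([aut_coefficients]). *)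

Import GRing.Theory.
Local Open Scope group_scope.

(** Cancelling [linv x] in [linv x * (x * linv x) = linv x] gives
  [x * linv x = 1], so [linv] is an involution; this is why the identity alone
  makes [linv] a bijection. *)
Lemma left_inverse_propertyE (L : loopType) :
  left_inverse_property L <-> forall x y : L, linv x * (x * y) = y.
Proof.
split=> [[iota [_ iK]] x y | linvK]; first by rewrite -(lip_iotaE iK).
exists (@linv L); split=> //.
suff linv_inv : involutive (@linv L) by exists (@linv L).
move=> x; apply/esym/linv_unique.
apply: (bij_inj (ltrans_bij (linv x))).
by rewrite linvK mulg1.
Qed.

Lemma aut_app_mul (A : zmodType) (f g : aut A) (a : A) : (f * g) a = f (g a).
Proof. by []. Qed.

Lemma aut_app_inv (A : zmodType) (f : aut A) (a : A) : f (f^-1 a) = a.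
Proof. exact: aut_invKV. Qed.

Lemma aut_inv_app (A : zmodType) (f : aut A) (a : A) : f^-1 (f a) = a.
Proof. exact: aut_invK. Qed.

Lemma linv_ext (A : zmodType) (L : loopType) (P Q : L -> L -> aut A)
    (PQ : loop_cocycle P Q) (x : L) (a : A) :
  linv ((x, a) : linear_extension PQ) =
    (linv x, (- (P (linv x) x)^-1%g (Q (linv x) x a))%R).
Proof.
apply/esym/linv_unique; congr (_, _) => /=; first exact: linv_mulg.
by rewrite raddfN /= aut_app_inv addNr.
Qed.

(** The left-hand side is the second component of [linv u * (u * v) = v] for
  [u = (x, a)] and [v = (y, b)], with [p = P x y], [q = Q x y],
  [p0 = P (linv x) x], [q0 = Q (linv x) x], [p1 = P (linv x) (x * y)] and
  [q1 = Q (linv x) (x * y)]. *)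
Lemma aut_coefficients (A : zmodType) (p q p0 q0 p1 q1 : aut A) :
  (forall a b : A, (p1 (- p0^-1%g (q0 a)) + q1 (p a + q b) = b)%R) <->
  q1 = q^-1 /\ p1 = q^-1 * p * q0^-1 * p0.
Proof.
split=> [eqb | [-> ->] a b]; last first.
  by rewrite raddfN raddfD !aut_app_mul !aut_app_inv !aut_inv_app addKr.
have q1E : q1 = q^-1.
  apply: autP => b; have := eqb 0%R (q^-1 b).
  by rewrite aut_app_inv !(raddf0, oppr0, add0r).
split=> //; apply: autP => a.
(* This argument turns [p0^-1 (q0 _)] into [a]. *)
have /eqP := eqb (q0^-1 (p0 a)) 0%R.
rewrite aut_app_inv aut_inv_app raddf0 addr0 raddfN addrC subr_eq0 q1E.
by move/eqP.
Qed.

Theorem proposition5 (A : zmodType) (L : loopType) (P Q : L -> L -> aut A)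
  (PQ : loop_cocycle P Q) :
  left_inverse_property (linear_extension PQ) <->
  left_inverse_property L /\
  (forall xi eta : L,
     Q (linv xi) (xi * eta) = (Q xi eta)^-1 /\
     P (linv xi) (xi * eta) =
       (Q xi eta)^-1 * P xi eta * (Q (linv xi) xi)^-1 * P (linv xi) xi).
Proof.
rewrite !left_inverse_propertyE; split=> [FK | [LK eqPQ] [x a] [y b]].
  split=> x y.
    by have := FK (x, 0%R) (y, 0%R); rewrite linv_ext => -[].
  apply/aut_coefficients => a b.
  by have := FK (x, a) (y, b); rewrite linv_ext => -[].
rewrite linv_ext; congr (_, _); first exact: LK.
by have /aut_coefficients := eqPQ x y; apply.
Qed.
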